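(* Every noetherian form over a bicategory $(\mathbb{C},\mathcal{E},\mathcal{M})$ having an exact join decomposition is optimal. Dually, every noetherian form over a bicategory having an exact meet decomposition is optimal.
   Context: Forms. A form over a category $\mathbb{C}$ is a faithful functor $F\colon\mathbb{B}\to\mathbb{C}$ that is amnestic (an isomorphism of $\mathbb{B}$ sent to an identity morphism is an identity morphism). Objects of $\mathbb{B}$ sent to $X$ are called ($F$-)clusters in $X$. For $f\colon X\to Y$, a cluster $A$ in $X$ and a cluster $B$ in $Y$, $B\geq_f A$ means that some morphism $A\to B$ of $\mathbb{B}$ is sent to $f$; $\geq$ denotes $\geq_{1_X}$, a partial order on the clusters in $X$. $F$ is orean if: (O1) for each $X$ the clusters in $X$ form a bounded lattice ($\bot_X,\top_X,\vee,\wedge$); (O2) for $f\colon X\to Y$, $g\colon Y\to Z$, if $C\geq_{gf}A$ then there is a cluster $B$ in $Y$ with $C\geq_g B$ and $B\geq_f A$; (O3) for $f\colon X\to Y$ and a cluster $S$ in $X$ there is a least cluster $f\cdot S$ in $Y$ among those $T$ with $T\geq_f S$, and for a cluster $T$ in $Y$ there is a largest cluster $T\cdot f$ in $X$ among those $S$ with $T\geq_f S$. For $f\colon X\to Y$ put $\mathrm{Im} f=f\cdot\top_X$, $\mathrm{Ker} f=\bot_Y\cdot f$. A cluster is conormal (normal) if it is the image (kernel) of some morphism. An orean form is conormal (normal) if all its clusters are. Operators. An operator $\tau\colon F\to G$ between forms over $\mathbb{C}$ is a functor between the domains with $G\circ\tau=F$; equivalently, a map of clusters over each object such that $B\geq_f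 A$ implies $\tau B\geq_f\tau A$. Isomorphisms of forms are invertible operators. A collection of $F$-clusters, with the relations $\geq_f$ restricted, is a subform of $F$. For an idempotent operator $\tau\colon F\to F$, $F_\tau$ is the subform of clusters $S$ with $\tau S=S$. An operator of orean forms is conormal if $\tau(\mathrm{Im}^F f)=\mathrm{Im}^G f$ for all $f$, normal if $\tau(\mathrm{Ker}^F f)=\mathrm{Ker}^G f$ for all $f$, binormal if both. Noetherian forms. For an orean form, an embedding of a conormal cluster $S$ in $X$ is a morphism $m\colon W\to X$ with $\mathrm{Im}\, m=S$ such that every $m'\colon W'\to X$ with $\mathrm{Im}\, m'\leq S$ factors uniquely as $m'=mg$. A quotient of a normal cluster $S$ in $X$ is a morphism $q\colon X\to Y$ with $\mathrm{Ker}\, q=S$ such that every $q'\colon X\to Y'$ with $\mathrm{Ker}\, q'\geq S$ factors uniquely as $q'=hq$. An orean form is noetherian if: (N1) for every $f\colon X\to Y$, $(f\cdot S)\cdot f=S\vee\mathrm{Ker} f$ for all clusters $S$ in $X$, and $f\cdot(T\cdot f)=T\wedge\mathrm{Im} f$ for all clusters $T$ in $Y$; (N2) every morphism $f$ factors as $f=me$ with $m$ an embedding of $\mathrm{Im} f$ and $e$ a quotient of $\mathrm{Ker} f$; (N3) the join of two normal clusters is normal and the meet of two conormal clusters is conormal. Exact decompositions. A join (meet) decomposition of an orean form $F$ is a pair $(\kappa_s,\kappa_e)$ of idempotent operators $F\to F$ such that $F_s=F_{\kappa_s}$ is a conormal orean form, $F_e=F_{\kappa_e}$ is a normal orean form,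 and $S=\kappa_s S\vee\kappa_e S$ (respectively $S=\kappa_s S\wedge\kappa_e S$) for every cluster $S$. It is exact if the restrictions $\tau_s\colon F\to F_s$, $\tau_e\colon F\to F_e$ of $\kappa_s,\kappa_e$ are binormal, there exist a conormal operator $F_s\to F_e$ and a normal operator $F_e\to F_s$, the subform inclusion $F_s\to F$ is conormal and the subform inclusion $F_e\to F$ is normal. Bicategories and optimality. A bicategory here is a triple $(\mathbb{C},\mathcal{E},\mathcal{M})$ with $\mathbb{C}$ a category and $\mathcal{E},\mathcal{M}$ classes of morphisms of $\mathbb{C}$. A noetherian form over the bicategory is a noetherian form $F$ over $\mathbb{C}$ such that $\mathcal{E}$ is the class of all $F$-quotients (quotients of normal $F$-clusters) and $\mathcal{M}$ is the class of all $F$-embeddings (embeddings of conormal $F$-clusters). A noetherian form over a bicategory is optimal if it is isomorphic to a subform of any other noetherian form over the same bicategory. *)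

(* Defs.v *)
From Stdlib Require Import ssreflect ssrfun ProofIrrelevance.

Set Implicit Arguments.
Unset Strict Implicit.
Unset Printing Implicit Defensive.

Record category := Category {
  ob :> Type;
  hom : ob -> ob -> Type;
  idm : forall X, hom X X;
  comp : forall X Y Z, hom Y Z -> hom X Y -> hom X Z;
  comp1m : forall X Y (f : hom X Y), comp (idm Y) f = f;
  compm1 : forall X Y (f : hom X Y), comp f (idm X) = f;
  compA : forall X Y Z W (h : hom Z W) (g : hom Y Z) (f : hom X Y),
    comp h (comp g f) = comp (comp h g) f
}.
Arguments hom {c} X Y.
Arguments idm {c} X.
Arguments comp {c X Y Z} g f.

Declare Scope form_scope.
Delimit Scope form_scope with form.
Local Open Scope form_scope.

Notation "g ∘ f" := (comp g f) (at level 40, left associativity) : form_scope.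

Record functor (B C : category) := Functor {
  fob :> B -> C;
  fmap : forall A A' : B, hom A A' -> hom (fob A) (fob A');
  fmap1 : forall A : B, fmap (idm A) = idm (fob A);
  fmapM : forall (A1 A2 A3 : B) (k : hom A2 A3) (h : hom A1 A2),
    fmap (k ∘ h) = fmap k ∘ fmap h
}.
Arguments fmap {B C} f {A A'} h.

Definition fid (C : category) : functor C C :=
  @Functor C C (fun A => A) (fun _ _ h => h)
    (fun _ => erefl) (fun _ _ _ _ _ => erefl).

Definition fcomp (A B C : category) (G : functor B C) (F : functor A B) :
  functor A C.
Proof.
apply: (@Functor A C (fun X => G (F X)) (fun X Y h => fmap G (fmap F h))).
- by move=> X; rewrite !fmap1.
- by move=> X Y Z k h; rewrite !fmapM.
Defined.

Definition is_iso (C : category) (X Y : C) (f : hom X Y) : Prop :=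
  exists g : hom Y X, g ∘ f = idm X /\ f ∘ g = idm Y.

Definition is_identity (C : category) (X Y : C) (f : hom X Y) : Prop :=
  exists e : X = Y, eq_rect X (@hom C X) (idm X) Y e = f.

Section FullSubcategory.
Variables (B : category) (P : B -> Prop).

Definition full_subcategory : category :=
  @Category {A : B | P A} (fun A A' => hom (sval A) (sval A'))
    (fun A => idm (sval A)) (fun _ _ _ k h => k ∘ h)
    (fun _ _ h => comp1m h) (fun _ _ h => compm1 h)
    (fun _ _ _ _ h3 h2 h1 => compA h3 h2 h1).

Definition full_inclusion : functor full_subcategory B :=
  @Functor full_subcategory B (fun A => sval A) (fun _ _ h => h)
    (fun _ => erefl) (fun _ _ _ _ _ => erefl).

Lemma full_is_iso (A A' : full_subcategory) (h : hom A A') :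
  is_iso h -> is_iso (fmap full_inclusion h).
Proof. by case=> k [kh hk]; exists k. Qed.

Lemma full_is_identity (A A' : full_subcategory) (h : hom A A') :
  is_identity (fmap full_inclusion h) -> is_identity h.
Proof.
case: A A' h => [A PA] [A' PA'] /= h [/= e].
case: A' / e PA' h => PA' h /= <-.
by rewrite (proof_irrelevance _ PA' PA); exists erefl.
Qed.

End FullSubcategory.

Record form (C : category) := Form {
  dom : category;
  form_functor :> functor dom C;
  faithful : forall (A A' : dom) (h k : hom A A'),
    fmap form_functor h = fmap form_functor k -> h = k;
  amnestic : forall (A A' : dom) (h : hom A A'),
    is_iso h -> is_identity (fmap form_functor h) -> is_identity h
}.
Arguments dom {C} f.

Record cluster (C : category) (F : form C) (X : C) := Cluster {
  cob : dom F;
  cobE : F cob = X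
}.

Definition cast_hom (C : category) (X X' Y Y' : C) (eX : X = X') (eY : Y = Y')
    (f : hom X Y) : hom X' Y' :=
  match eX in _ = X1, eY in _ = Y1 return hom X1 Y1 with
  | erefl, erefl => f
  end.

Definition geq (C : category) (F : form C) (X Y : C) (f : hom X Y)
    (B : cluster F Y) (A : cluster F X) : Prop :=
  exists h : hom (cob A) (cob B), cast_hom (cobE A) (cobE B) (fmap F h) = f.

Notation "B ≥[ f ] A" := (geq f B A)
  (at level 70, f at level 200, no associativity) : form_scope.
Notation "A ⊑ B" := (geq (idm _) B A) (at level 70, no associativity)
  : form_scope.

(* Every object A of [dom F] is a cluster in exactly one object, namely F A, so
   a collection of clusters is a predicate on [dom F]. *)
Section Subform.
Variables (C : category) (F : form C) (P : dom F -> Prop).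

Definition subform : form C.
Proof.
apply: (@Form C (full_subcategory P) (fcomp F (full_inclusion P))).
- by move=> A A' h k; apply: faithful.
- move=> A A' h /full_is_iso isoh idh.
  by apply: full_is_identity; apply: amnestic.
Defined.

End Subform.

Record operator (C : category) (F G : form C) := Operator {
  op_functor :> functor (dom F) (dom G);
  op_over : fcomp G op_functor = F
}.

Definition op_cluster (C : category) (F G : form C) (tau : operator F G)
    (X : C) (S : cluster F X) : cluster G X :=
  Cluster (etrans (f_equal (fun T : functor (dom F) C => T (cob S))
                           (op_over tau)) (cobE S)).

Definition isomorphic (C : category) (F G : form C) : Prop :=
  exists (a : operator F G) (b : operator G F),
    fcomp b a = fid (dom F) /\ fcomp a b = fid (dom G).

Definition idempotent_op (C : category) (F : form C) (k : operator F F) : Prop :=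
  fcomp k k = k.

Definition inclusion (C : category) (F : form C) (P : dom F -> Prop) :
    operator (subform P) F :=
  @Operator C (subform P) F (full_inclusion P) erefl.

Section Fixed.
Variables (C : category) (F : form C) (k : operator F F).

Definition fixed : form C := subform (fun A : dom F => k A = A).

Hypothesis kk : idempotent_op k.

Definition restriction_functor : functor (dom F) (dom fixed) :=
  @Functor (dom F) (dom fixed)
    (fun A => exist (fun A : dom F => k A = A) (k A)
                (f_equal (fun T : functor (dom F) (dom F) => T A) kk))
    (fun _ _ h => fmap k h) (fun A => fmap1 k A) (fun _ _ _ h2 h1 => fmapM k h2 h1).

Lemma restriction_over : fcomp fixed restriction_functor = F.
Proof.
rewrite -[RHS](op_over k) /fcomp; f_equal; exact: proof_irrelevance.
Qed.

Definition restriction : operator F fixed := Operator restriction_over.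

End Fixed.

(* The operations are determined by the form, since ⊑ is antisymmetric. *)
Record orean (C : category) (F : form C) := Orean {
  bot : forall X : C, cluster F X;
  top : forall X : C, cluster F X;
  join : forall X : C, cluster F X -> cluster F X -> cluster F X;
  meet : forall X : C, cluster F X -> cluster F X -> cluster F X;
  dimg : forall (X Y : C) (f : hom X Y), cluster F X -> cluster F Y;
  iimg : forall (X Y : C) (f : hom X Y), cluster F Y -> cluster F X;
  bot_le : forall X (S : cluster F X), bot X ⊑ S;
  le_top : forall X (S : cluster F X), S ⊑ top X;
  le_joinl : forall X (S T : cluster F X), S ⊑ join S T;
  le_joinr : forall X (S T : cluster F X), T ⊑ join S T;
  join_le : forall X (S T U : cluster F X), S ⊑ U -> T ⊑ U -> join S T ⊑ U;
  meet_lel : forall X (S T : cluster F X), meet S T ⊑ S;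
  meet_ler : forall X (S T : cluster F X), meet S T ⊑ T;
  le_meet : forall X (S T U : cluster F X), U ⊑ S -> U ⊑ T -> U ⊑ meet S T;
  geq_split : forall X Y Z (f : hom X Y) (g : hom Y Z)
    (A : cluster F X) (D : cluster F Z), D ≥[g ∘ f] A ->
    exists B : cluster F Y, D ≥[g] B /\ B ≥[f] A;
  dimg_geq : forall X Y (f : hom X Y) (S : cluster F X), dimg f S ≥[f] S;
  dimg_least : forall X Y (f : hom X Y) (S : cluster F X) (T : cluster F Y),
    T ≥[f] S -> dimg f S ⊑ T;
  geq_iimg : forall X Y (f : hom X Y) (T : cluster F Y), T ≥[f] iimg f T;
  iimg_largest : forall X Y (f : hom X Y) (S : cluster F X) (T : cluster F Y),
    T ≥[f] S -> S ⊑ iimg f T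
}.
Arguments bot {C F} o X.
Arguments top {C F} o X.
Arguments join {C F} o {X} S T : rename.
Arguments meet {C F} o {X} S T : rename.
Arguments dimg {C F} o {X Y} f S : rename.
Arguments iimg {C F} o {X Y} f T : rename.

Section OreanForms.
Variables (C : category) (F : form C) (O : orean F).

Definition Im (X Y : C) (f : hom X Y) : cluster F Y := dimg O f (top O X).
Definition Ker (X Y : C) (f : hom X Y) : cluster F X := iimg O f (bot O Y).

Definition conormal_cluster (X : C) (S : cluster F X) : Prop :=
  exists (W : C) (f : hom W X), Im f = S.
Definition normal_cluster (X : C) (S : cluster F X) : Prop :=
  exists (Y : C) (f : hom X Y), Ker f = S.

Definition conormal_form : Prop :=
  forall (X : C) (S : cluster F X), conormal_cluster S.
Definition normal_form : Prop :=
  forall (X : C) (S : cluster F X), normal_cluster S.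

Definition embedding_of (W X : C) (m : hom W X) (S : cluster F X) : Prop :=
  Im m = S /\
  forall (W' : C) (m' : hom W' X), Im m' ⊑ S ->
    exists! g : hom W' W, m' = m ∘ g.

Definition quotient_of (X Y : C) (q : hom X Y) (S : cluster F X) : Prop :=
  Ker q = S /\
  forall (Y' : C) (q' : hom X Y'), S ⊑ Ker q' ->
    exists! h : hom Y Y', q' = h ∘ q.

Definition is_embedding (W X : C) (m : hom W X) : Prop :=
  exists S : cluster F X, conormal_cluster S /\ embedding_of m S.
Definition is_quotient (X Y : C) (q : hom X Y) : Prop :=
  exists S : cluster F X, normal_cluster S /\ quotient_of q S.

Record noetherian : Prop := Noetherian {
  iimg_dimg : forall (X Y : C) (f : hom X Y) (S : cluster F X),
    iimg O f (dimg O f S) = join O S (Ker f);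
  dimg_iimg : forall (X Y : C) (f : hom X Y) (T : cluster F Y),
    dimg O f (iimg O f T) = meet O T (Im f);
  factorization : forall (X Y : C) (f : hom X Y),
    exists (Z : C) (m : hom Z Y) (e : hom X Z),
      f = m ∘ e /\ embedding_of m (Im f) /\ quotient_of e (Ker f);
  normal_join : forall (X : C) (S T : cluster F X),
    normal_cluster S -> normal_cluster T -> normal_cluster (join O S T);
  conormal_meet : forall (X : C) (S T : cluster F X),
    conormal_cluster S -> conormal_cluster T -> conormal_cluster (meet O S T)
}.

End OreanForms.

Definition conormal_op (C : category) (F G : form C) (OF : orean F)
    (OG : orean G) (tau : operator F G) : Prop :=
  forall (X Y : C) (f : hom X Y), op_cluster tau (Im OF f) = Im OG f.
Definition normal_op (C : category) (F G : form C) (OF : orean F)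
    (OG : orean G) (tau : operator F G) : Prop :=
  forall (X Y : C) (f : hom X Y), op_cluster tau (Ker OF f) = Ker OG f.
Definition binormal_op (C : category) (F G : form C) (OF : orean F)
    (OG : orean G) (tau : operator F G) : Prop :=
  conormal_op OF OG tau /\ normal_op OF OG tau.

(* The operation [op] is either the join or the meet of F. *)
Record decomposition (C : category) (F : form C)
    (op : forall X : C, cluster F X -> cluster F X -> cluster F X) :=
  Decomposition {
  ks : operator F F;
  ke : operator F F;
  ks_idem : idempotent_op ks;
  ke_idem : idempotent_op ke;
  orean_s : orean (fixed ks);
  orean_e : orean (fixed ke);
  conormal_s : conormal_form orean_s;
  normal_e : normal_form orean_e;
  decompose : forall (X : C) (S : cluster F X),
    S = op X (op_cluster ks S) (op_cluster ke S)
}.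

Definition join_decomposition (C : category) (F : form C) (O : orean F) :=
  decomposition (@join C F O).
Definition meet_decomposition (C : category) (F : form C) (O : orean F) :=
  decomposition (@meet C F O).

Record exact (C : category) (F : form C) (O : orean F)
    (op : forall X : C, cluster F X -> cluster F X -> cluster F X)
    (D : decomposition op) : Prop := Exact {
  restriction_s_binormal :
    binormal_op O (orean_s D) (restriction (ks_idem D));
  restriction_e_binormal :
    binormal_op O (orean_e D) (restriction (ke_idem D));
  conormal_s_e : exists tau : operator (fixed (ks D)) (fixed (ke D)),
    conormal_op (orean_s D) (orean_e D) tau;
  normal_e_s : exists tau : operator (fixed (ke D)) (fixed (ks D)),
    normal_op (orean_e D) (orean_s D) tau;
  inclusion_s_conormal :
    conormal_op (orean_s D) O (inclusion (fun A : dom F => ks D A = A));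
  inclusion_e_normal :
    normal_op (orean_e D) O (inclusion (fun A : dom F => ke D A = A))
}.

Record bicategory := Bicategory {
  bicat :> category;
  classE : forall X Y : bicat, hom X Y -> Prop;
  classM : forall X Y : bicat, hom X Y -> Prop
}.

Definition noetherian_over (B : bicategory) (F : form B) (O : orean F) : Prop :=
  noetherian O /\
  (forall (X Y : B) (e : hom X Y), classE e <-> is_quotient O e) /\
  (forall (X Y : B) (m : hom X Y), classM m <-> is_embedding O m).

Definition optimal (B : bicategory) (F : form B) (O : orean F) : Prop :=
  noetherian_over O /\
  forall (G : form B) (OG : orean G), noetherian_over OG ->
    exists P : dom G -> Prop, isomorphic F (subform P).

(* Main.v *)
(** The operators of an exact join decomposition are interiors: [ks S] is the
largest conormal and [ke S] the largest normal cluster below [S].  Writing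
[ks S = Im a] and [ke S = Ker b], the cluster [Im a ∨ Ker b] of another
noetherian form G over the same bicategory depends only on [S], because the
classes E and M determine the order between images and the order between
kernels.  This assignment preserves the relations [≥[f]] since [ks] and [ke] are
operators.  It reflects them because [S = Im a ∨ Ker b] is the inverse image
along [b] of [Im (b ∘ a)], a cluster above no nonzero normal one: any morphism
[d] with [Im d] below [Im (b ∘ a)] then has the largest normal cluster as its
kernel, a condition that can be read in G, where it forces a kernel contained in
[k⁻¹ (Im (b ∘ a))] to be contained in [Ker k].  The meet case is dual, with the
roles of [ks] and [ke] exchanged. *)

From Stdlib Require Import ssreflect ssrbool ssrfun ProofIrrelevance.
From Stdlib Require Import FunctionalExtensionality IndefiniteDescription.
Require Import Defs.

Set Implicit Arguments.
Unset Strict Implicit.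
Unset Printing Implicit Defensive.

Local Open Scope form_scope.

(** * Noetherian lattices over a category, and their duals *)

(* An orean form with the domain category forgotten, so that duality is a mere
   swap of fields. *)
Record lform (C : category) := LForm {
  cl : C -> Type;
  cle : forall X, cl X -> cl X -> Prop;
  cle_refl : forall X (S : cl X), cle S S;
  cle_trans : forall X (S T U : cl X), cle S T -> cle T U -> cle S U;
  cle_anti : forall X (S T : cl X), cle S T -> cle T S -> S = T;
  cbot : forall X, cl X;
  ctop : forall X, cl X;
  cjoin : forall X, cl X -> cl X -> cl X;
  cmeet : forall X, cl X -> cl X -> cl X;
  push : forall X Y (f : hom X Y), cl X -> cl Y;
  pull : forall X Y (f : hom X Y), cl Y -> cl X;
  cbot_le : forall X (S : cl X), cle (cbot X) S;
  cle_top : forall X (S : cl X), cle S (ctop X);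
  cle_joinl : forall X (S T : cl X), cle S (cjoin S T);
  cle_joinr : forall X (S T : cl X), cle T (cjoin S T);
  cjoin_le : forall X (S T U : cl X), cle S U -> cle T U -> cle (cjoin S T) U;
  cmeet_lel : forall X (S T : cl X), cle (cmeet S T) S;
  cmeet_ler : forall X (S T : cl X), cle (cmeet S T) T;
  cle_meet : forall X (S T U : cl X), cle U S -> cle U T -> cle U (cmeet S T);
  push_pull_adj : forall X Y (f : hom X Y) (S : cl X) (T : cl Y),
    cle (push f S) T <-> cle S (pull f T);
  push1 : forall X (S : cl X), push (idm X) S = S;
  pull1 : forall X (S : cl X), pull (idm X) S = S;
  push_comp : forall X Y Z (g : hom Y Z) (f : hom X Y) (S : cl X),
    push (g ∘ f) S = push g (push f S);
  pull_comp : forall X Y Z (g : hom Y Z) (f : hom X Y) (T : cl Z),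
    pull (g ∘ f) T = pull f (pull g T)
}.
Arguments cbot {C} l X.
Arguments ctop {C} l X.
Arguments push {C} l {X Y} f S.
Arguments pull {C} l {X Y} f T.

Notation "S ≤ T" := (cle S T) (at level 70, no associativity) : form_scope.

Section NoetherianLattices.
Variables (C : category) (N : lform C).

Definition cIm (X Y : C) (f : hom X Y) : cl N Y := push N f (ctop N X).
Definition cKer (X Y : C) (f : hom X Y) : cl N X := pull N f (cbot N Y).

(** The embedded cluster can only be the image of [m], so it is not a parameter; likewise for [quo]
    and the kernel. *)
Definition emb (W X : C) (m : hom W X) : Prop :=
  forall (W' : C) (m' : hom W' X), cIm m' ≤ cIm m ->
    exists! g : hom W' W, m' = m ∘ g.
Definition quo (X Y : C) (q : hom X Y) : Prop :=
  forall (Y' : C) (q' : hom X Y'), cKer q ≤ cKer q' ->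
    exists! h : hom Y Y', q' = h ∘ q.

(** Normal and conormal clusters enter through morphisms presenting them, so duality merely
    exchanges the fields: the first with the second, the fourth with the fifth. *)
Record noeth : Prop := Noeth {
  pull_push : forall (X Y : C) (f : hom X Y) (S : cl N X),
    pull N f (push N f S) = cjoin S (cKer f);
  push_pull : forall (X Y : C) (f : hom X Y) (T : cl N Y),
    push N f (pull N f T) = cmeet T (cIm f);
  factor : forall (X Y : C) (f : hom X Y),
    exists (Z : C) (m : hom Z Y) (e : hom X Z),
      f = m ∘ e /\ (emb m /\ cIm m = cIm f) /\ (quo e /\ cKer e = cKer f);
  ker_join : forall (X Y Z : C) (f : hom X Y) (g : hom X Z),
    exists (V : C) (h : hom X V), cKer h = cjoin (cKer f) (cKer g);
  im_meet : forall (X Y Z : C) (f : hom X Z) (g : hom Y Z),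
    exists (V : C) (h : hom V Z), cIm h = cmeet (cIm f) (cIm g)
}.

Lemma le_pull (X Y : C) (f : hom X Y) (S : cl N X) (T : cl N Y) :
  push N f S ≤ T -> S ≤ pull N f T.
Proof. by move/push_pull_adj. Qed.

Lemma push_le (X Y : C) (f : hom X Y) (S : cl N X) (T : cl N Y) :
  S ≤ pull N f T -> push N f S ≤ T.
Proof. by move/push_pull_adj. Qed.

Lemma push_mono (X Y : C) (f : hom X Y) (S T : cl N X) :
  S ≤ T -> push N f S ≤ push N f T.
Proof.
move=> ST; apply: push_le; apply: cle_trans ST _.
exact/le_pull/cle_refl.
Qed.

Lemma pull_mono (X Y : C) (f : hom X Y) (S T : cl N Y) :
  S ≤ T -> pull N f S ≤ pull N f T.
Proof.
move=> ST; apply: le_pull; apply: cle_trans ST.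
exact/push_le/cle_refl.
Qed.

Lemma push_ker (X Y : C) (f : hom X Y) : push N f (cKer f) ≤ cbot N Y.
Proof. exact/push_le/cle_refl. Qed.

Lemma im_comp (X Y Z : C) (g : hom Y Z) (f : hom X Y) :
  cIm (g ∘ f) = push N g (cIm f).
Proof. exact: push_comp. Qed.

Lemma ker_comp (X Y Z : C) (g : hom Y Z) (f : hom X Y) :
  cKer (g ∘ f) = pull N f (cKer g).
Proof. exact: pull_comp. Qed.

Lemma im_comp_le (X Y Z : C) (g : hom Y Z) (f : hom X Y) :
  cIm (g ∘ f) ≤ cIm g.
Proof. by rewrite im_comp; apply/push_mono/cle_top. Qed.

Hypothesis noethN : noeth.

(** Write [q = m ∘ e] with [e] of the same kernel as [q], so that [e = h ∘ q]. Uniqueness in the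
    universal property of [q] gives [m ∘ h = idm Y], so the image of [m], which is that of [q], is
    everything. *)
Lemma im_quo (X Y : C) (q : hom X Y) : quo q -> cIm q = ctop N Y.
Proof.
move=> quoq; have [Z [m [e [qE [[_ <-] [_ keE]]]]]] := factor noethN q.
have [|h [eE _]] := quoq _ e; first by rewrite keE; apply: cle_refl.
have [g [_ g_uniq]] := quoq _ q (cle_refl _).
have mh1 : m ∘ h = idm Y.
  apply: (@etrans _ _ g); last by apply: g_uniq; rewrite comp1m.
  by symmetry; apply: g_uniq; rewrite -compA -eE.
apply: cle_anti; first exact: cle_top.
by have := im_comp_le m h; rewrite mh1 /cIm push1.
Qed.

Lemma ker_emb (X Y : C) (m : hom X Y) : emb m -> cKer m = cbot N X.
Proof.
move=> embm; have [Z [n [e [mE [[_ inE] [_ <-]]]]]] := factor noethN m.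
have [|h [nE _]] := embm _ n; first by rewrite inE; apply: cle_refl.
have [g [_ g_uniq]] := embm _ m (cle_refl _).
have he1 : h ∘ e = idm X.
  apply: (@etrans _ _ g); last by apply: g_uniq; rewrite compm1.
  by symmetry; apply: g_uniq; rewrite compA -nE.
apply: cle_anti; last exact: cbot_le.
rewrite -[X in _ ≤ X]pull1 -he1 pull_comp.
exact/pull_mono/cbot_le.
Qed.

Lemma push_pull_quo (X Y : C) (q : hom X Y) (T : cl N Y) :
  quo q -> push N q (pull N q T) = T.
Proof.
move=> quoq; rewrite (push_pull noethN) (im_quo quoq).
apply: cle_anti; first exact: cmeet_lel.
by apply: cle_meet; [exact: cle_refl|exact: cle_top].
Qed.

Lemma pull_push_emb (X Y : C) (m : hom X Y) (S : cl N X) :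
  emb m -> pull N m (push N m S) = S.
Proof.
move=> embm; rewrite (pull_push noethN) (ker_emb embm).
apply: cle_anti; last exact: cle_joinl.
by apply: cjoin_le; [exact: cle_refl|exact: cbot_le].
Qed.

Lemma le_push_ker (X Y Z : C) (f : hom X Y) (g : hom Y Z) (S : cl N Y) :
  S ≤ cKer g -> S ≤ cIm f -> S ≤ push N f (cKer (g ∘ f)).
Proof.
by move=> Sg Sf; rewrite ker_comp (push_pull noethN); apply: cle_meet.
Qed.

Lemma join_im_ker (W X Y : C) (a : hom W X) (b : hom X Y) :
  cjoin (cIm a) (cKer b) = pull N b (cIm (b ∘ a)).
Proof. by rewrite im_comp (pull_push noethN). Qed.

(* With [k = m ∘ q], intersecting [Im h] with [Im m] yields [d = m ∘ n], and a
   normal cluster over [Ker k] inside [k⁻¹ (Im h)] is pushed by [q] into the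
   image under [n] of a kernel, hence of [Ker d]. *)
Lemma ker_le_of_ker_le_pull_im (U V W X : C) (b : hom X U) (k : hom X V)
    (h : hom W V) :
  (forall (D : C) (d : hom D V), cIm d ≤ cIm h ->
     forall (Y : C) (u : hom D Y), cKer u ≤ cKer d) ->
  cKer b ≤ pull N k (cIm h) -> cKer b ≤ cKer k.
Proof.
move=> ker_max bh.
have [P [p pE]] := ker_join noethN b k.
have [Z [m [q [kE [[embm imE] [quoq kqE]]]]]] := factor noethN k.
have [D [d dE]] := im_meet noethN m h.
have [|n [dn _]] := embm _ d; first by rewrite dE; apply: cmeet_lel.
have [|r [pr _]] := quoq _ p; first by rewrite kqE pE; apply: cle_joinr.
(* The image of Ker p under [k] lies below Im m and Im h, hence below Im d = m · Im n; then the
   embedding [m] is cancelled. *)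
have pd : push N m (push N q (cKer p)) ≤ push N m (cIm n).
  rewrite -push_comp -kE -im_comp -dn dE; apply: cle_meet.
    by rewrite imE; apply/push_mono/cle_top.
  apply: push_le; rewrite pE; apply: cjoin_le => //.
  exact/pull_mono/cbot_le.
have qn : push N q (cKer p) ≤ cIm n.
  by move/le_pull: pd; rewrite pull_push_emb.
have qr : push N q (cKer p) ≤ cKer r.
  by apply: push_le; rewrite pr ker_comp; apply: cle_refl.
have d_max : cKer (r ∘ n) ≤ cKer d.
  by apply: ker_max; rewrite dE; apply: cmeet_ler.
(* The cluster q · Ker p, lying below Ker r and Im n, is covered by n · Ker (r ∘ n); applying [m]
   gives d · Ker (r ∘ n), which is zero by [d_max]. *)
have kp : cKer p ≤ cKer k.
  apply: le_pull; rewrite kE push_comp.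
  apply: cle_trans (push_mono m (le_push_ker qr qn)) _.
  rewrite -push_comp -dn.
  exact: cle_trans (push_mono d d_max) (push_ker d).
by apply: cle_trans kp; rewrite pE; apply: cle_joinl.
Qed.

End NoetherianLattices.
Arguments cIm {C} N {X Y} f.
Arguments cKer {C} N {X Y} f.
Arguments emb {C} N {W X} m.
Arguments quo {C} N {X Y} q.
Arguments push_ker {C N X Y} f.

Definition op_category (C : category) : category :=
  @Category C (fun X Y => hom Y X) (fun X => idm X) (fun _ _ _ g f => f ∘ g)
    (fun _ _ f => compm1 f) (fun _ _ f => comp1m f)
    (fun _ _ _ _ h g f => esym (compA f g h)).

(** Reversing arrows and order at once makes images and kernels, and embeddings and quotients, trade
    places by conversion. *)
Definition op_lform (C : category) (N : lform C) : lform (op_category C) :=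
  @LForm (op_category C) (cl N) (fun X S T => T ≤ S) (@cle_refl _ N)
    (fun X S T U ST TU => cle_trans TU ST)
    (fun X S T ST TS => cle_anti TS ST)
    (ctop N) (cbot N) (@cmeet _ N) (@cjoin _ N)
    (fun X Y f => pull N (f : @hom C Y X)) (fun X Y f => push N (f : @hom C Y X))
    (@cle_top _ N) (@cbot_le _ N) (@cmeet_lel _ N) (@cmeet_ler _ N)
    (fun X S T U => @cle_meet _ N X S T U)
    (@cle_joinl _ N) (@cle_joinr _ N) (fun X S T U => @cjoin_le _ N X S T U)
    (fun X Y f S T => iff_sym (@push_pull_adj _ N Y X f T S))
    (@pull1 _ N) (@push1 _ N)
    (fun X Y Z g f S => @pull_comp _ N Z Y X f g S)
    (fun X Y Z g f S => @push_comp _ N Z Y X f g S).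

Lemma op_noeth (C : category) (N : lform C) : noeth N -> noeth (op_lform N).
Proof.
case=> pp1 pp2 fac kj im; split.
- by move=> X Y f S; apply: pp2.
- by move=> X Y f S; apply: pp1.
- move=> X Y f; have [Z [m [e [fE [Hm He]]]]] := fac _ _ f.
  by exists Z, e, m; split; [exact: fE|split; [exact: He|exact: Hm]].
- by move=> X Y Z f g; apply: im.
- by move=> X Y Z f g; apply: kj.
Qed.

(** * Comparing two noetherian lattices with the same embeddings and quotients *)

(** An inequality of images in [N] amounts to a factorization of [f] through the embedding part [m]
    of [g], a fact about the category alone. In [M] the images of [g] and [m] agree, because the
    quotient part has full image there. *)
Lemma im_le_transfer (C : category) (N M : lform C) : noeth N -> noeth M ->
  (forall (X Y : C) (e : hom X Y), quo N e -> quo M e) ->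
  forall (X Y Z : C) (f : hom X Z) (g : hom Y Z),
    cIm N f ≤ cIm N g -> cIm M f ≤ cIm M g.
Proof.
move=> nN nM quoNM X Y Z f g.
have [V [m [e [gE [[embm <-] [quoe _]]]]]] := factor nN g.
move=> /embm [h [-> _]].
by rewrite gE [X in _ ≤ X]im_comp (im_quo nM (quoNM _ _ _ quoe)); apply: im_comp_le.
Qed.

Lemma ker_le_transfer (C : category) (N M : lform C) : noeth N -> noeth M ->
  (forall (X Y : C) (m : hom X Y), emb N m -> emb M m) ->
  forall (X Y Z : C) (f : hom X Y) (g : hom X Z),
    cKer N f ≤ cKer N g -> cKer M f ≤ cKer M g.
Proof.
move=> nN nM embNM X Y Z f g.
apply: (@im_le_transfer _ (op_lform N) (op_lform M) (op_noeth nN) (op_noeth nM)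
         (fun X Y => @embNM Y X) Z Y X g f).
Qed.

(** The inequality [push N f S ≤ T] renders the relation T ≥_f S, which operators preserve. *)
Definition lform_op (C : category) (N : lform C)
    (k : forall X : C, cl N X -> cl N X) : Prop :=
  forall (X Y : C) (f : hom X Y) (S : cl N X) (T : cl N Y),
    push N f S ≤ T -> push N f (k X S) ≤ k Y T.

Definition order_embedding (C : category) (N M : lform C)
    (phi : forall X : C, cl N X -> cl M X) : Prop :=
  forall (X Y : C) (f : hom X Y) (S : cl N X) (T : cl N Y),
    push N f S ≤ T <-> push M f (phi X S) ≤ phi Y T.

Section Embedding.
Variables (C : category) (N M : lform C).
Hypotheses (nN : noeth N) (nM : noeth M).
Hypothesis embE : forall (X Y : C) (m : hom X Y), emb N m <-> emb M m.
Hypothesis quoE : forall (X Y : C) (q : hom X Y), quo N q <-> quo M q.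
Variables s e : forall X : C, cl N X -> cl N X.
Hypotheses (s_op : lform_op s) (e_op : lform_op e).
Hypothesis s_im : forall (X : C) (S : cl N X),
  exists (W : C) (a : hom W X), cIm N a = s S.
Hypothesis e_ker : forall (X : C) (S : cl N X),
  exists (Y : C) (b : hom X Y), cKer N b = e S.
Hypothesis e_fix : forall (X Y : C) (f : hom X Y), e (cKer N f) = cKer N f.
Hypothesis joinE : forall (X : C) (S : cl N X), S = cjoin (s S) (e S).

Let imE (X Y Z : C) (f : hom X Z) (g : hom Y Z) :
  cIm N f ≤ cIm N g <-> cIm M f ≤ cIm M g.
Proof. by split; apply: im_le_transfer => // ? ? ? /quoE. Qed.

Let kerE (X Y Z : C) (f : hom X Y) (g : hom X Z) :
  cKer N f ≤ cKer N g <-> cKer M f ≤ cKer M g.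
Proof. by split; apply: ker_le_transfer => // ? ? ? /embE. Qed.

Lemma e_mono (X : C) (S T : cl N X) : S ≤ T -> e S ≤ e T.
Proof. by move=> ST; rewrite -(push1 (e S)); apply: e_op; rewrite push1. Qed.

Lemma e_le (X : C) (S : cl N X) : e S ≤ S.
Proof. by rewrite [X in _ ≤ X]joinE; apply: cle_joinr. Qed.

(** Write e (Im (b ∘ a)) = Ker c. Then Ker (c ∘ b) lies below b⁻¹ (Im (b ∘ a)) = S and, being fixed
    by [e], below e S = Ker b. Pushing along the quotient [b] recovers Ker c and kills Ker b. *)
Lemma e_im_bot (W X Y : C) (a : hom W X) (b : hom X Y) (S : cl N X) :
  cIm N a = s S -> cKer N b = e S -> quo N b -> e (cIm N (b ∘ a)) ≤ cbot N Y.
Proof.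
move=> aS bS quob.
have [V [c cE]] := e_ker (cIm N (b ∘ a)).
have cb : cKer N (c ∘ b) ≤ cKer N b.
  rewrite -e_fix bS; apply: e_mono.
  rewrite [X in _ ≤ X]joinE -aS -bS (join_im_ker nN) ker_comp cE.
  exact/pull_mono/e_le.
rewrite -cE -(push_pull_quo nN (cKer N c) quob) -ker_comp.
exact: cle_trans (push_mono b cb) (push_ker b).
Qed.

(** Since d · Ker u lies below Im h, applying the operator [e], which fixes kernels, puts it below e
    (Im h), the bottom. The conclusion compares only kernels, so it transfers to [M]. *)
Lemma ker_max (D W Y V : C) (h : hom W V) (d : hom D V) (u : hom D Y) :
  e (cIm N h) ≤ cbot N V -> cIm N d ≤ cIm N h -> cKer N u ≤ cKer N d.
Proof.
move=> h0 dh; apply: le_pull; apply: cle_trans h0.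
rewrite -e_fix; apply: e_op; apply: cle_trans dh.
exact/push_mono/cle_top.
Qed.

(** A relation rather than a map, since [a] and [b] are only known to exist; [related_le] at an
    identity shows that [S] determines [T]. That [b] is a quotient serves [e_im_bot]. *)
Definition related (X : C) (S : cl N X) (T : cl M X) : Prop :=
  exists (W Y : C) (a : hom W X) (b : hom X Y),
    cIm N a = s S /\ cKer N b = e S /\ quo N b /\
    T = cjoin (cIm M a) (cKer M b).

Lemma related_total (X : C) (S : cl N X) : exists T, related S T.
Proof.
have [W [a aS]] := s_im S; have [Y [b bS]] := e_ker S.
(* The quotient part of [b] has the same kernel and replaces it. *)
have [Z [_ [q [_ [_ [quoq qb]]]]]] := factor nN b.
exists (cjoin (cIm M a) (cKer M q)), W, Z, a, q.
by rewrite qb.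
Qed.

Lemma related_le (X Y : C) (f : hom X Y) (S : cl N X) (T : cl N Y) S' T' :
  related S S' -> related T T' -> push N f S ≤ T <-> push M f S' ≤ T'.
Proof.
move=> [W [U [a [b [aS [bS [_ ->]]]]]]] [W' [U' [a' [b' [aT [bT [quob' ->]]]]]]].
have TE : T = cjoin (cIm N a') (cKer N b') by rewrite aT bT -joinE.
split=> H; apply: push_le.
  apply: cjoin_le.
    apply: le_pull; rewrite -im_comp.
    apply: (@cle_trans _ _ _ _ (cIm M a')); last exact: cle_joinl.
    by apply/imE; rewrite im_comp aS aT; apply: s_op.
  apply: (@cle_trans _ _ _ _ (pull M f (cKer M b'))); last exact/pull_mono/cle_joinr.
  rewrite -ker_comp; apply/kerE; rewrite ker_comp bS bT.
  exact/le_pull/e_op.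
(* Writing the bound as an inverse image along [b'] leaves a single image on the right of [H]. *)
have {}H : cjoin (cIm M a) (cKer M b) ≤ pull M (b' ∘ f) (cIm M (b' ∘ a')).
  by rewrite pull_comp -(join_im_ker nM); apply: le_pull.
rewrite {1}(joinE S) -aS -bS; apply: cjoin_le.
  rewrite TE (join_im_ker nN) -pull_comp.
  apply: le_pull; rewrite -im_comp; apply/imE; rewrite im_comp.
  apply: push_le; exact: cle_trans (cle_joinl _ _) H.
(* The bound that [H] puts on Ker b is not an order between kernels; it is first sharpened in [M] to
   Ker b ≤ Ker (b' ∘ f), which transfers to [N]. *)
apply: (@cle_trans _ _ _ _ (cKer N (b' ∘ f))); last first.
  by rewrite ker_comp; apply: pull_mono; rewrite TE; apply: cle_joinr.
apply/kerE; apply: (ker_le_of_ker_le_pull_im nM (h := b' ∘ a')).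
  move=> D d /imE dh V u; apply/kerE; apply: ker_max dh.
  exact: e_im_bot aT bT quob'.
exact: cle_trans (cle_joinr _ _) H.
Qed.

Lemma join_order_embedding : exists phi : forall X : C, cl N X -> cl M X,
  order_embedding phi.
Proof.
exists (fun X S => proj1_sig (constructive_indefinite_description _
                                (related_total S))) => X Y f S T.
by apply: related_le; apply: proj2_sig.
Qed.

End Embedding.

(** The join case over the opposite category, where images are kernels: [e] takes the place of [s],
    and [s_fix] that of [e_fix]. *)
Lemma meet_order_embedding (C : category) (N M : lform C)
    (s e : forall X : C, cl N X -> cl N X) :
  noeth N -> noeth M ->
  (forall (X Y : C) (m : hom X Y), emb N m <-> emb M m) ->
  (forall (X Y : C) (q : hom X Y), quo N q <-> quo M q) ->
  lform_op s -> lform_op e ->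
  (forall (X : C) (S : cl N X), exists (W : C) (a : hom W X), cIm N a = s X S) ->
  (forall (X : C) (S : cl N X), exists (Y : C) (b : hom X Y), cKer N b = e X S) ->
  (forall (X Y : C) (f : hom X Y), s Y (cIm N f) = cIm N f) ->
  (forall (X : C) (S : cl N X), S = cmeet (s X S) (e X S)) ->
  exists phi : forall X : C, cl N X -> cl M X, order_embedding phi.
Proof.
move=> nN nM embE quoE s_op e_op s_im e_ker s_fix meetE.
have op_op (k : forall X, cl N X -> cl N X) :
    lform_op k -> @lform_op _ (op_lform N) k.
  move=> k_op X Y f S T H; apply: (@le_pull _ N Y X f).
  by apply: k_op; apply: (@push_le _ N Y X f).
have [|phi phiE] := @join_order_embedding _ (op_lform N) (op_lform M)
  (op_noeth nN) (op_noeth nM) (fun X Y => @quoE Y X) (fun X Y => @embE Y X)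
  e s (op_op _ e_op) (op_op _ s_op) e_ker s_im (fun X Y => @s_fix Y X).
  move=> X S; rewrite [LHS]meetE; apply: (@cle_anti _ N);
    by apply: cle_meet; [exact: cmeet_ler|exact: cmeet_lel].
exists phi => X Y f S T.
have H := phiE Y X f T S.
by split=> K; apply: push_le; apply/H; apply: le_pull.
Qed.

(** * The noetherian lattice of a noetherian form *)

Lemma cluster_eq (C : category) (F : form C) (X : C) (S T : cluster F X) :
  cob S = cob T -> S = T.
Proof.
case: S T => [A eA] [A' eA'] /= e; case: A' / e eA' => eA'.
by rewrite (proof_irrelevance _ eA eA').
Qed.

Lemma cast_hom_id (C : category) (X Y : C) (eX : X = X) (eY : Y = Y)
    (f : hom X Y) : cast_hom eX eY f = f.
Proof.
by rewrite (proof_irrelevance _ eX erefl) (proof_irrelevance _ eY erefl).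
Qed.

Lemma geq_trans (C : category) (F : form C) (X Y Z : C) (f : hom X Y)
    (g : hom Y Z) (A : cluster F X) (B : cluster F Y) (D : cluster F Z) :
  D ≥[g] B -> B ≥[f] A -> D ≥[g ∘ f] A.
Proof.
case: A B D => [A eA] [B eB] [D eD]; move: f g.
case: X / eA; case: Y / eB; case: Z / eD => f g [k /= <-] [h /= <-].
by exists (k ∘ h); rewrite /= fmapM.
Qed.

Lemma geq_weaken (C : category) (F : form C) (X Y : C) (f : hom X Y)
    (A A' : cluster F X) (B B' : cluster F Y) :
  A' ⊑ A -> B ⊑ B' -> B ≥[f] A -> B' ≥[f] A'.
Proof.
move=> HA HB H; rewrite -(comp1m f) -(compm1 (idm Y ∘ f)).
by apply: geq_trans HA; apply: geq_trans H.
Qed.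

Lemma sub_refl (C : category) (F : form C) (X : C) (S : cluster F X) : S ⊑ S.
Proof. by case: S => A e; case: X / e; exists (idm A); apply: fmap1. Qed.

Lemma sub_trans (C : category) (F : form C) (X : C) (S T U : cluster F X) :
  S ⊑ T -> T ⊑ U -> S ⊑ U.
Proof. by move=> ST TU; apply: (geq_weaken ST (sub_refl U)). Qed.

Lemma cast_hom_inverse (C : category) (X Y : C) (e : X = Y) (f : hom X Y)
    (g : hom Y X) :
  cast_hom e erefl f = idm Y -> cast_hom erefl e g = idm Y ->
  [/\ g ∘ f = idm X, f ∘ g = idm Y & is_identity f].
Proof.
case: Y / e f g => /= f g -> ->.
by rewrite comp1m; split=> //; exists erefl.
Qed.

(** By faithfulness the morphisms over the identity in both directions are mutually inverse, and
    amnesticity makes such an isomorphism an identity, so the two objects coincide. *)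
Lemma sub_anti (C : category) (F : form C) (X : C) (S T : cluster F X) :
  S ⊑ T -> T ⊑ S -> S = T.
Proof.
case: S T => [A eA] [A' eA']; case: X / eA' eA => eA [h hE] [k kE].
apply: cluster_eq => /=.
have [kh hk idh] := cast_hom_inverse hE kE.
have [e _] : is_identity h; last exact: e.
apply: (amnestic _ idh); exists k.
by split; apply: faithful; rewrite fmapM fmap1.
Qed.

Lemma geq_dimgE (C : category) (F : form C) (O : orean F) (X Y : C)
    (f : hom X Y) (S : cluster F X) (T : cluster F Y) :
  T ≥[f] S <-> dimg O f S ⊑ T.
Proof.
split; first exact: dimg_least.
by move=> H; apply: geq_weaken (sub_refl S) H (dimg_geq O f S).
Qed.

Lemma geq_iimgE (C : category) (F : form C) (O : orean F) (X Y : C)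
    (f : hom X Y) (S : cluster F X) (T : cluster F Y) :
  T ≥[f] S <-> S ⊑ iimg O f T.
Proof.
split; first exact: iimg_largest.
by move=> H; apply: geq_weaken H (sub_refl T) (geq_iimg O f T).
Qed.

Definition lform_of (C : category) (F : form C) (O : orean F) : lform C.
Proof.
apply: (@LForm C (cluster F) (fun X S T => S ⊑ T) (@sub_refl C F)
  (@sub_trans C F) (@sub_anti C F) (bot O) (top O) (@join C F O) (@meet C F O)
  (@dimg C F O) (@iimg C F O) (@bot_le C F O) (@le_top C F O)
  (@le_joinl C F O) (@le_joinr C F O) (@join_le C F O) (@meet_lel C F O)
  (@meet_ler C F O) (@le_meet C F O)).
- by move=> X Y f S T; rewrite -geq_dimgE -geq_iimgE.
- move=> X S; apply: sub_anti; first exact: dimg_least (sub_refl S).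
  exact: dimg_geq.
- move=> X S; apply: sub_anti; first exact: geq_iimg.
  exact: iimg_largest (sub_refl S).
(* One inequality comes from composing relations, the other from [geq_split], which cuts the
   relation over [g ∘ f] at a cluster in [Y]. Inverse images are treated alike. *)
- move=> X Y Z g f S; apply: sub_anti.
    by apply: dimg_least; apply: geq_trans (dimg_geq _ _ _) (dimg_geq _ _ _).
  have [B [gB fB]] := geq_split O (dimg_geq O (g ∘ f) S).
  by apply: dimg_least; apply: geq_weaken gB; [exact: dimg_least|exact: sub_refl].
- move=> X Y Z g f T; apply: sub_anti; last first.
    by apply: iimg_largest; apply: geq_trans (geq_iimg _ _ _) (geq_iimg _ _ _).
  have [B [gB fB]] := geq_split O (geq_iimg O (g ∘ f) T).
  by apply: iimg_largest; apply: geq_weaken fB; [exact: sub_refl|exact: iimg_largest].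
Defined.

Lemma is_embeddingE (C : category) (F : form C) (O : orean F) (X Y : C)
    (m : hom X Y) : is_embedding O m <-> emb (lform_of O) m.
Proof.
split; first by move=> [S [_ [<- H]]] W m' /H.
by move=> H; exists (Im O m); split; [exists X, m|split=> // W m' /H].
Qed.

Lemma is_quotientE (C : category) (F : form C) (O : orean F) (X Y : C)
    (q : hom X Y) : is_quotient O q <-> quo (lform_of O) q.
Proof.
split; first by move=> [S [_ [<- H]]] W m' /H.
by move=> H; exists (Ker O q); split; [exists Y, q|split=> // W m' /H].
Qed.

Lemma noeth_of (C : category) (F : form C) (O : orean F) :
  noetherian O -> noeth (lform_of O).
Proof.
case=> pp1 pp2 fac nj cm; split; [exact: pp1|exact: pp2| | |].
- move=> X Y f; have [Z [m [e [fE [[mE Hm] [eE He]]]]]] := fac _ _ f.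
  exists Z, m, e; split=> //; split; split=> //.
    by move=> W m'; rewrite [cIm _ m]mE; apply: Hm.
  by move=> W q'; rewrite [cKer _ e]eE; apply: He.
- by move=> X Y Z f g; apply: nj; [exists Y, f|exists Z, g].
- by move=> X Y Z f g; apply: cm; [exists X, f|exists Y, g].
Qed.

(** An operator commutes with the forms only up to an equality of functors; this carries such an
    equality through the casts in [geq]. *)
Lemma cast_fmap_eq (K C : category) (P Q : functor K C) (A B : K)
    (h : hom A B) (X Y : C) (pA : P A = X) (pB : P B = Y) (qA : Q A = X)
    (qB : Q B = Y) :
  P = Q -> cast_hom pA pB (fmap P h) = cast_hom qA qB (fmap Q h).
Proof.
move=> e; case: Q / e qA qB => qA qB.
by rewrite (proof_irrelevance _ pA qA) (proof_irrelevance _ pB qB).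
Qed.

Lemma op_geq (C : category) (F G : form C) (tau : operator F G) (X Y : C)
    (f : hom X Y) (A : cluster F X) (B : cluster F Y) :
  B ≥[f] A -> op_cluster tau B ≥[f] op_cluster tau A.
Proof.
case=> h <-; exists (fmap tau h).
exact: (cast_fmap_eq h _ _ _ _ (op_over tau)).
Qed.

(** * Exact decompositions seen on clusters *)

Section Decomposition.
Variables (C : category) (F : form C) (O : orean F).
Variable op : forall X : C, cluster F X -> cluster F X -> cluster F X.
Variables (D : decomposition op) (exD : exact O D).

(** Exactness speaks of the restriction and of the inclusion separately; this composite brings its
    conditions back to operators on [F]. *)
Lemma op_cluster_restriction (k : operator F F) (kk : idempotent_op k) (X : C)
    (S : cluster F X) :
  op_cluster (inclusion (fun A => k A = A)) (op_cluster (restriction kk) S) =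
  op_cluster k S.
Proof. exact: cluster_eq. Qed.

Lemma ks_conormal (X : C) (S : cluster F X) :
  conormal_cluster O (op_cluster (ks D) S).
Proof.
have [W [f fE]] := conormal_s (op_cluster (restriction (ks_idem D)) S).
exists W, f; rewrite -(op_cluster_restriction (ks_idem D)) -fE.
by rewrite (inclusion_s_conormal exD).
Qed.

Lemma ke_normal (X : C) (S : cluster F X) :
  normal_cluster O (op_cluster (ke D) S).
Proof.
have [Y [f fE]] := normal_e (op_cluster (restriction (ke_idem D)) S).
exists Y, f; rewrite -(op_cluster_restriction (ke_idem D)) -fE.
by rewrite (inclusion_e_normal exD).
Qed.

Lemma ks_im (X Y : C) (f : hom X Y) : op_cluster (ks D) (Im O f) = Im O f.
Proof.
rewrite -(op_cluster_restriction (ks_idem D)) (restriction_s_binormal exD).1.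
exact: (inclusion_s_conormal exD).
Qed.

Lemma ke_ker (X Y : C) (f : hom X Y) : op_cluster (ke D) (Ker O f) = Ker O f.
Proof.
rewrite -(op_cluster_restriction (ke_idem D)) (restriction_e_binormal exD).2.
exact: (inclusion_e_normal exD).
Qed.

End Decomposition.

Lemma lform_op_of (C : category) (F : form C) (O : orean F) (k : operator F F) :
  @lform_op C (lform_of O) (fun X S => op_cluster k S).
Proof.
move=> X Y f S T ST; apply: (dimg_least O); apply: op_geq.
exact/(geq_dimgE O).
Qed.

(** * From cluster maps to isomorphisms of forms *)

Lemma functor_ext (K C : category) (P Q : functor K C)
    (e : forall A : K, P A = Q A) :
  (forall (A B : K) (h : hom A B),
     cast_hom (e A) (e B) (fmap P h) = fmap Q h) -> P = Q.
Proof.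
case: P Q e => [P p p1 pM] [Q q q1 qM] /= e H.
have PQ : P = Q by apply: functional_extensionality.
case: Q / PQ q q1 qM e H => q q1 qM e H.
have pq : p = q.
  do 3![apply: functional_extensionality_dep => ?].
  by rewrite -H cast_hom_id.
case: q / pq q1 qM {H} => q1 qM.
by rewrite (proof_irrelevance _ p1 q1) (proof_irrelevance _ pM qM).
Qed.

Lemma fcompA (A B C D : category) (H : functor C D) (G : functor B C)
    (F : functor A B) : fcomp H (fcomp G F) = fcomp (fcomp H G) F.
Proof. by rewrite /fcomp; f_equal; apply: proof_irrelevance. Qed.

Lemma fcomp_id (A B : category) (F : functor A B) : fcomp F (fid A) = F.
Proof. by case: F => *; rewrite /fcomp; f_equal; apply: proof_irrelevance. Qed.

(** Faithfulness of [G] reduces the comparison of morphisms to [C], where the equality of the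
    composites decides. *)
Lemma functor_into_form (K C : category) (G : form C)
    (P Q : functor K (dom G)) :
  (forall A : K, P A = Q A) -> fcomp G P = fcomp G Q -> P = Q.
Proof.
move=> e GPQ; apply: (functor_ext (e := e)) => A B h; apply: faithful.
have castE (X X' Y Y' : dom G) (eX : X = X') (eY : Y = Y') (k : hom X Y) :
    fmap G (cast_hom eX eY k) =
    cast_hom (f_equal G eX) (f_equal G eY) (fmap G k).
  by case: X' / eX; case: Y' / eY.
rewrite castE -[RHS](cast_hom_id erefl erefl).
exact: (cast_fmap_eq h _ _ _ _ GPQ).
Qed.

(** Lifts of morphisms are picked by choice; faithfulness of [G] makes them unique, hence
    functorial. *)
Lemma operator_of_objects (C : category) (F G : form C) (o : dom F -> dom G)
    (e : forall A, G (o A) = F A) :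
  (forall (A A' : dom F) (h : hom A A'), exists k : hom (o A) (o A'),
     cast_hom (e A) (e A') (fmap G k) = fmap F h) ->
  exists tau : operator F G, forall A, tau A = o A.
Proof.
move=> lift.
pose m A A' h := proj1_sig (constructive_indefinite_description _ (lift A A' h)).
have mE A A' h : cast_hom (e A) (e A') (fmap G (m A A' h)) = fmap F h.
  exact: proj2_sig (constructive_indefinite_description _ (lift A A' h)).
have castI (X X' Y Y' : C) (eX : X = X') (eY : Y = Y') (f g : hom X Y) :
    cast_hom eX eY f = cast_hom eX eY g -> f = g.
  by case: X' / eX; case: Y' / eY.
have cast1 (X X' : C) (eX : X = X') : cast_hom eX eX (idm X) = idm X'.
  by case: X' / eX.
have castM (X X' Y Y' Z Z' : C) (eX : X = X') (eY : Y = Y') (eZ : Z = Z')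
    (g : hom Y Z) (f : hom X Y) :
    cast_hom eX eZ (g ∘ f) = cast_hom eY eZ g ∘ cast_hom eX eY f.
  by case: X' / eX; case: Y' / eY; case: Z' / eZ.
have m1 A : m A A (idm A) = idm (o A).
  apply: faithful; apply: (castI _ _ _ _ (e A) (e A)).
  by rewrite mE !fmap1 cast1.
have mM A1 A2 A3 (k : hom A2 A3) (h : hom A1 A2) :
    m _ _ (k ∘ h) = m _ _ k ∘ m _ _ h.
  apply: faithful; apply: (castI _ _ _ _ (e A1) (e A3)).
  by rewrite mE !fmapM (castM _ _ _ _ _ _ _ (e A2)) !mE.
pose T := @Functor (dom F) (dom G) o m m1 mM.
have TE : fcomp G T = F.
  exact: (@functor_ext _ _ (fcomp G T) F e (fun A B h => mE A B h)).
by exists (Operator TE).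
Qed.

(** The subform is the range of [phi]. Since [phi] preserves and reflects the relations, it is
    injective by antisymmetry and full onto its range. *)
Lemma isomorphic_subform (C : category) (F G : form C)
    (phi : forall X : C, cluster F X -> cluster G X) :
  (forall (X Y : C) (f : hom X Y) (S : cluster F X) (T : cluster F Y),
     T ≥[f] S <-> phi Y T ≥[f] phi X S) ->
  exists P : dom G -> Prop, isomorphic F (subform P).
Proof.
move=> phiE.
pose o A := cob (phi _ (Cluster (erefl (F A)))).
have oE A : G (o A) = F A by apply: cobE.
have fullo A A' (f : hom (F A) (F A')) :
    (exists h : hom A A', fmap F h = f) <->
    (exists k : hom (o A) (o A'), cast_hom (oE A) (oE A') (fmap G k) = f).
  have := phiE _ _ f (Cluster (erefl (F A))) (Cluster (erefl (F A'))).
  rewrite /geq /= (proof_irrelevance _ (cobE _) (oE A)).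
  by rewrite (proof_irrelevance _ (cobE _) (oE A')).
have phio X A (eA : F A = X) : cob (phi X (Cluster eA)) = o A by case: X / eA.
have oI A A' : o A = o A' -> A = A'.
  (* Antisymmetry needs both objects over the same base object, so [A] is read as a cluster in
     [F A']. *)
  move=> oAA'; have FAA' : F A = F A' by rewrite -!oE oAA'.
  suff: Cluster FAA' = Cluster (erefl (F A')) by move/(f_equal (@cob _ _ _)).
  have phiA : phi _ (Cluster FAA') = phi _ (Cluster (erefl (F A'))).
    by apply: cluster_eq; rewrite phio.
  by apply: sub_anti; apply/phiE; rewrite phiA; apply: sub_refl.
pose P B := exists A, o A = B.
pose oP A : dom (subform P) := exist P (o A) (ex_intro _ A erefl).
pose o' (B : dom (subform P)) : dom F :=
  proj1_sig (constructive_indefinite_description _ (proj2_sig B)).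
have o'K B : o (o' B) = sval B.
  exact: proj2_sig (constructive_indefinite_description _ (proj2_sig B)).
have o'E B : F (o' B) = subform P B by rewrite /= -o'K oE.
have [a aE] : exists a : operator F (subform P), forall A, a A = oP A.
  apply: (@operator_of_objects _ _ (subform P) oP oE) => A A' h.
  by apply/fullo; exists h.
have [b bE] : exists b : operator (subform P) F, forall B, b B = o' B.
  apply: (operator_of_objects (e := o'E)) => B B' k.
  (* Stated for arbitrary [D] and [D'] so that the equalities, later instances of [o'K], can be
     eliminated. *)
  have lift' A A' D D' (eA : o A = D) (eA' : o A' = D') (p : F A = G D)
      (p' : F A' = G D') (l : hom D D') :
      exists h : hom A A', cast_hom p p' (fmap F h) = fmap G l.
    case: D / eA p l => p l; case: D' / eA' p' l => p' l.
    have [_ [|h hE]] := fullo A A' (cast_hom (oE A) (oE A') (fmap G l)).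
      by exists l.
    exists h; rewrite hE; move: p p' (oE A) (oE A') (fmap G l) => /= p p' q q'.
    by case: _ / q p; case: _ / q' p' => p' p f; rewrite cast_hom_id.
  exact: (lift' _ _ _ _ (o'K B) (o'K B')).
exists P, a, b; split.
  apply: (@functor_into_form _ _ F) => [A|].
    by rewrite /= bE; apply: oI; rewrite o'K aE.
  by rewrite fcompA (op_over b) (op_over a) fcomp_id.
apply: (@functor_into_form _ _ (subform P)) => [[B PB]|].
  rewrite /= aE bE /oP.
  move: (o' _) (o'K (exist _ B PB)) => A /= oA.
  by case: B / oA PB => PB; f_equal; apply: proof_irrelevance.
by rewrite fcompA (op_over a) (op_over b) fcomp_id.
Qed.

Theorem theorem182 (B : bicategory) :
  (forall (F : form B) (O : orean F), noetherian_over O ->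
     (exists D : join_decomposition O, exact O D) -> optimal O) /\
  (forall (F : form B) (O : orean F), noetherian_over O ->
     (exists D : meet_decomposition O, exact O D) -> optimal O).
Proof.
(* The embeddings and quotients of both forms are the two classes of the bicategory. *)
have agree (F G : form B) (O : orean F) (OG : orean G) :
    noetherian_over O -> noetherian_over OG ->
    (forall (X Y : B) (m : hom X Y),
       emb (lform_of O) m <-> emb (lform_of OG) m) /\
    (forall (X Y : B) (q : hom X Y),
       quo (lform_of O) q <-> quo (lform_of OG) q).
  move=> [_ [EF MF]] [_ [EG MG]]; split=> X Y f.
    by rewrite -!is_embeddingE -MF -MG.
  by rewrite -!is_quotientE -EF -EG.
have optimalI (F : form B) (O : orean F) : noetherian_over O ->
    (forall (G : form B) (OG : orean G), noetherian_over OG ->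
       exists phi : forall X : B, cl (lform_of O) X -> cl (lform_of OG) X,
         order_embedding phi) -> optimal O.
  move=> nF H; split=> // G OG /H [phi phiE].
  apply: (isomorphic_subform (phi := phi)) => X Y f S T.
  by rewrite (geq_dimgE O) (geq_dimgE OG); apply: phiE.
split=> F O nF [D exD]; apply: optimalI => // G OG nG;
  have [embE quoE] := agree _ _ _ _ nF nG.
- apply: (join_order_embedding (noeth_of nF.1) (noeth_of nG.1) embE quoE
            (lform_op_of (O := O) (ks D)) (lform_op_of (O := O) (ke D))).
  + exact: ks_conormal.
  + exact: ke_normal.
  + exact: ke_ker.
  + exact: decompose.
- apply: (meet_order_embedding (noeth_of nF.1) (noeth_of nG.1) embE quoE
            (lform_op_of (O := O) (ks D)) (lform_op_of (O := O) (ke D))).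
  + exact: ks_conormal.
  + exact: ke_normal.
  + exact: ks_im.
  + exact: decompose.
Qed.
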